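(* Let $k\ge3$ be a fixed integer. There exists a constant $R_k>0$ (depending only on $k$) such that for any bounded interval $I$, any $u\in H^k(I)$, any $\ell\in\{2,\dots,k-1\}$ and any $\varepsilon\in(0,1)$, $$\varepsilon^{\gamma_\ell}\|u^{(\ell)}\|_{L^2(I)}^2\le R_k\Big(\|u'\|_{L^2(I)}^2+\varepsilon^{2k-1}\|u^{(k)}\|_{L^2(I)}^2+\frac{\varepsilon^{\gamma_\ell}}{|I|^{2(\ell-1)}}\|u'\|_{L^2(I)}^2\Big),$$ where $\gamma_\ell=\frac{2k-1}{k-1}(\ell-1)$.
   Context: $|I|$ denotes the length of the (nondegenerate, open) interval $I\subset\mathbb R$; $u^{(\ell)}$ denotes the $\ell$-th derivative. *)

(* Defs.v *)
From HB Require Import structures.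
From mathcomp Require Export all_boot all_order all_algebra.
From mathcomp Require Export all_classical all_reals all_analysis.

Set Implicit Arguments.
Unset Strict Implicit.
Unset Printing Implicit Defensive.
Import Order.TTheory GRing.Theory Num.Theory.
Import numFieldNormedType.Exports.

Local Open Scope classical_set_scope.
Local Open Scope ring_scope.

(** Functions on an open set [D] of the real line are represented by total
    functions [R -> R] whose values outside [D] are irrelevant. *)

Definition test_function (R : realType) (D : set R) (phi : R -> R) : Prop :=
  (forall n x, derivable (derive1n n phi) x 1) /\
  (exists K : set R, [/\ compact K, K `<=` D & forall x, ~ K x -> phi x = 0]).

Definition weak_derivative (R : realType) (D : set R) (j : nat)
    (u v : R -> R) : Prop :=
  [/\ locally_integrable D u, locally_integrable D v &
    forall phi : R -> R, test_function D phi ->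
      \int[lebesgue_measure]_(x in D) (u x * derive1n j phi x) =
      (-1) ^+ j * \int[lebesgue_measure]_(x in D) (v x * phi x)].

Definition L2 (R : realType) (D : set R) (f : R -> R) : Prop :=
  f \_ D \in Lfun (@lebesgue_measure R) 2%:E.

Definition L2norm (R : realType) (D : set R) (f : R -> R) : \bar R :=
  'N[@lebesgue_measure R]_(2%:E)[EFin \o (f \_ D)]%E.

Definition Hk (R : realType) (k : nat) (D : set R) (u : R -> R) : Prop :=
  L2 D u /\
  (forall j, (1 <= j <= k)%N -> exists2 v, weak_derivative D j u v & L2 D v).

Definition gamma_exp (R : realType) (k l : nat) : R :=
  (2 * k%:R - 1) / (k%:R - 1) * (l%:R - 1).

(* Main.v *)
Require Import Defs.
Import Order.TTheory GRing.Theory Num.Theory.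
Import numFieldNormedType.Exports.
From mathcomp Require Import ring lra zify measurable_realfun.

(** Put [w_j = u^(j+1)], so that [w_(j+1)] is the weak derivative of [w_j].
    Let [f, g, h] be three consecutive [w_j] and [J] an interval of length [r].
    Testing the weak derivative [h] of [g] against the difference of two smooth
    steps, a fixed one [S] and one concentrating at a Lebesgue point [p] of [g],
    bounds [|g p - \int_J g S'|] by the [L^1] norm of [h], while testing [g]
    against [S'] turns [\int_J g S'] into [- \int_J f S''], which is
    [O(r^-2 \int_J |f|)].  Squaring, integrating over [J] and tiling [I] by
    intervals of length comparable to [r] gives
    [|g|^2 <= C (r^-2 |f|^2 + r^2 |h|^2)] in [L^2(I)] for all [r <= |I|].
    A discrete log-convexity argument upgrades this to
    [r^(2m) |w_m|^2 <= K (|w_0|^2 + r^(2n) |w_n|^2)] with [m = l-1], [n = k-1],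
    which is used at [r = min(eps^((2k-1)/(2(k-1))), |I|)]. *)

Set Implicit Arguments.
Unset Strict Implicit.
Unset Printing Implicit Defensive.

Local Open Scope classical_set_scope.
Local Open Scope ring_scope.

(** * Smooth step functions *)

(** The bound forces [f x = 0], and the difference quotient at [x] is then at most [C * |h|]. This
    differentiates [flat] at [0], at [1] and beyond, where no formula is available. *)
Lemma is_derive0_sqr_bound (R : realType) (f : R -> R) (x C : R) :
  (forall y, `|f y| <= C * (y - x) ^+ 2) -> is_derive x 1 f 0.
Proof.
move=> fC.
have fx : f x = 0.
  by apply/eqP; rewrite -normr_le0 (le_trans (fC x))// subrr expr0n mulr0.
have C0 : 0 <= C.
  by have := le_trans (normr_ge0 _) (fC (x + 1)); rewrite addrC addKr expr1n mulr1.
have lim0 : (fun h : R => h^-1 *: (f (h *: 1 + x) - f x)) @ 0^' --> (0 : R).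
  apply/cvgr0Pnorm_lt => e e0; near=> h.
  have h0 : h != 0 by near: h; exact: nbhs_dnbhs_neq.
  rewrite fx subr0 normrZ normfV [h *: 1]mulr1 mulrC ltr_pdivrMr ?normr_gt0//.
  rewrite (le_lt_trans (fC _))// addrK -[X in _ * X]real_normK ?num_real// expr2.
  rewrite mulrA ltr_pM2r ?normr_gt0//.
  (* [C] may be [0], so [C + 1] is the number to divide by. *)
  rewrite (@le_lt_trans _ _ ((C + 1) * `|h|))// ?ler_wpM2r ?lerDl//.
  rewrite mulrC -ltr_pdivlMr ?ltr_wpDl//.
  near: h; apply: (@cvgr0_norm_lt _ _ _ _ _ id); last by rewrite divr_gt0// ltr_wpDl.
  exact: nbhs_dnbhs.
by split; [apply/cvg_ex; exists 0|exact/cvg_lim].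
Unshelve. all: by end_near. Qed.

Section flat_function.
Variable R : realType.
Implicit Types (p : {poly R}) (k : nat) (x : R).

(** This class of functions is closed under differentiation, which gives
    smoothness at the endpoints without Taylor expansions there. *)
Definition flat p k x : R :=
  if 0 < x < 1
  then p.[x] * (x * (1 - x)) ^- k * expR (- (x * (1 - x))^-1) else 0.

(** The numerator of the derivative of [p / q ^ k * exp (- 1 / q)] over
    [q ^ (k + 2)], where [q = x (1 - x)]. *)
Definition dflat p k : {poly R} :=
  p^`() * ('X * (1 - 'X)) ^+ 2
  + (1 - k%:R%:P * ('X * (1 - 'X))) * (1 - 'X *+ 2) * p.

(** The exponential beats every power: [exp (- 1 / q) <= (k + 2)! q ^ (k + 2)] absorbs [q ^- k] and
    leaves [q ^ 2], while the polynomial is bounded on [[0, 1]]. The remaining square is what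
    [is_derive0_sqr_bound] asks for. *)
Lemma flat_bound p k :
  exists C, forall y, `|flat p k y| <= C * (y * (1 - y)) ^+ 2.
Proof.
have [M [_ pM]] : bounded_set (horner p @` `[0, 1]).
  apply: compact_bounded; apply: continuous_compact; last exact: segment_compact.
  by apply: continuous_subspaceT; exact: continuous_horner.
exists ((`|M| + 1) * (k.+2)`!%:R) => y; rewrite /flat.
case: ifPn => [/andP[y0 y1]|_]; last first.
  by rewrite normr0 mulr_ge0 ?sqr_ge0// mulr_ge0// addr_ge0.
set q := y * (1 - y).
have q0 : 0 < q by rewrite mulr_gt0// subr_gt0.
have ple : `|p.[y]| <= `|M| + 1.
  apply: (pM (`|M| + 1)); first by rewrite ltr_pwDr// ler_norm.
  by exists y => //=; rewrite in_itv/= (ltW y0) (ltW y1).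
(* This is the term of order [k + 2] of the exponential series at [q^-1]. *)
have ele : expR (- q^-1) <= (k.+2)`!%:R * q ^+ k.+2.
  rewrite expRN -[leRHS]invrK lef_pV2 ?posrE ?expR_gt0//; last first.
    by rewrite invr_gt0 mulr_gt0 ?exprn_gt0// ltr0n fact_gt0.
  apply: le_trans (expR_ge1Dxn k.+1 _); last by rewrite invr_ge0 ltW.
  by rewrite invfM exprVn mulrC ler_wpDl.
rewrite !normrM (ger0_norm (expR_ge0 _)) -mulrA -[leRHS]mulrA ler_pM//.
rewrite (le_trans (ler_wpM2l _ ele))//.
rewrite normfV normrX (gtr0_norm q0) mulrCA -[k.+2]addn2 exprD mulKf//.
by rewrite expf_neq0// gt_eqF.
Qed.

Lemma is_derive_flat p k x :
  is_derive x 1 (flat p k) (flat (dflat p k) k.+2 x).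
Proof.
have [/andP[x0 x1]|x01] := boolP (0 < x < 1); last first.
  (* For [x] outside the open unit interval and [y] inside it, [y (1 - y) <= |y - x|], so
     [flat_bound] gives a quadratic bound around [x]. *)
  rewrite {2}/flat (negbTE x01); have [C pC] := flat_bound p k.
  have C0 : 0 <= C.
    have := le_trans (normr_ge0 _) (pC 2^-1).
    by rewrite pmulr_lge0// exprn_gt0//; lra.
  apply: (@is_derive0_sqr_bound _ _ _ C) => y.
  have [/andP[y0 y1]|y01] := boolP (0 < y < 1); last first.
    by rewrite /flat (negbTE y01) normr0 mulr_ge0 ?sqr_ge0.
  rewrite (le_trans (pC y))// ler_wpM2l// -[leRHS]real_normK ?num_real//.
  rewrite ler_sqr ?nnegrE//; last by rewrite mulr_ge0 ?subr_ge0// ltW.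
  move: x01; rewrite negb_and -!leNgt => /orP[x0|x1].
    by rewrite ger0_norm; nra.
  by rewrite ler0_norm; nra.
have q0 : x * (1 - x) != 0 by rewrite mulf_neq0// gt_eqF// subr_gt0.
pose q (y : R) : R := y * (1 - y).
have dq : is_derive x 1 q (1 - x *+ 2).
  have h : is_derive x 1 ((id : R -> R) * (cst 1 - id)) (x *: (0 - 1) + (1 - x) *: 1).
    exact: is_deriveM.
  apply: (is_derive_eq h).
  by rewrite sub0r scalerN /GRing.scale/= !mulr1 mulr2n; ring.
have dqV : is_derive x 1 (fun y => (q y)^-1) (- (q x) ^- 2 *: (1 - x *+ 2)).
  by split; [exact: derivableV|rewrite deriveV// derive_val].
have dqk : is_derive x 1 ((fun y => (q y)^-1) ^+ k)
    ((k%:R * (q x)^-1 ^+ k.-1) *: (- (q x) ^- 2 *: (1 - x *+ 2))).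
  exact: is_deriveX.
have dexp := is_derive1_comp (is_derive_expR _) (is_deriveN dqV).
have := is_deriveM (is_deriveM (is_derive_poly p x) dqk) dexp.
rewrite /GRing.scale/=.
set d := (X in is_derive _ _ _ X) => dF.
have qX y : ((fun y => (q y)^-1) ^+ k) y = (q y) ^- k.
  by rewrite exprfctE exprVn.
have -> : flat (dflat p k) k.+2 x = d.
  rewrite /flat x0 x1 /= /d /dflat !hornerE /= qX.
  rewrite -[(- (fun y : R => (q y)^-1)) x]/(- (q x)^-1).
  rewrite -[((_ : R -> R) * _) x]/(p.[x] * ((fun y : R => (q y)^-1) ^+ k) x) qX.
  rewrite -[x * (1 - x)]/(q x) in q0 *.
  have kE : k%:R * (q x)^-1 ^+ k.-1 = k%:R * (q x ^- k * q x).
    (* At [k = 0] the exponent [k.-1] is [0] as well, and the factor [k%:R] makes both sides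
       vanish. *)
    by case: (k) => [|k']; rewrite ?mul0r// exprVn exprS invfM mulrAC mulVf// mul1r.
  have kE2 : (q x ^+ k.+2)^-1 = q x ^- k * q x ^- 2 by rewrite -[k.+2]addn2 exprD invfM.
  rewrite -[p.[x] * k%:R * _]mulrA kE kE2.
  move: (q x ^- k) (expR _) => w e.
  by rewrite /q; field; apply/andP; split; rewrite gt_eqF// subr_gt0.
(* The unconditional formula agrees with [flat] only on the open unit interval, which is a
   neighbourhood of [x]. *)
apply: near_eq_is_derive dF; near=> y.
have y01 : 0 < y < 1.
  by apply/andP; split; near: y; [exact: lt_nbhsr|exact: lt_nbhsl].
rewrite /flat y01.
rewrite -[LHS]/(p.[y] * ((fun y : R => (q y)^-1) ^+ k) y * expR (- (q y)^-1)).
by rewrite qX.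
Unshelve. all: by end_near. Qed.

Lemma derive1_flat p k : derive1 (flat p k) = flat (dflat p k) k.+2.
Proof.
by apply/funext => x; rewrite derive1E; have [_ ->] := is_derive_flat p k x.
Qed.

Lemma flat_smooth p k n x : derivable (derive1n n (flat p k)) x 1.
Proof.
elim: n p k => [|n IH] p k; first by have [] := is_derive_flat p k x.
by rewrite derive1Sn derive1_flat.
Qed.

End flat_function.

(** * Calculus of smooth functions and rescaled steps *)

Definition smooth (R : realType) (f : R -> R) :=
  forall n x, derivable (derive1n n f) x 1.

Section smooth_functions.
Context {R : realType}.
Implicit Types f g : R -> R.

Lemma smooth_derive1n f n : smooth f -> smooth (derive1n n f).
Proof.
by move=> fs m x; rewrite /derive1n -iterD; exact: fs.
Qed.

Lemma is_derive_affine f (c a b x df : R) : is_derive (a * x + b) 1 f df ->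
  is_derive x 1 (fun x => c * f (a * x + b)) (c * (df * a)).
Proof.
move=> fdf.
have da : is_derive x 1 (fun y : R => a * y + b) a.
  have h : is_derive x 1 ((a \*: (id : R -> R)) + cst b) (a *: 1 + 0).
    exact: is_deriveD.
  by apply: (is_derive_eq h); rewrite addr0 /GRing.scale/= mulr1.
exact: is_deriveZ (@is_derive1_comp _ _ (fun y : R => a * y + b) _ _ _ fdf da).
Qed.

Lemma derive1n_affine f (c a b : R) n : smooth f ->
  derive1n n (fun x => c * f (a * x + b)) =
  (fun x => c * a ^+ n * derive1n n f (a * x + b)).
Proof.
move=> fs; elim: n => [|n IH]; first by apply/funext => x; rewrite mulr1.
rewrite derive1nS IH; apply/funext => x; rewrite derive1E.
have df : is_derive (a * x + b) 1 (derive1n n f) (derive1n n.+1 f (a * x + b)).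
  by rewrite derive1nS derive1E; apply: DeriveDef => //; exact: fs.
by have [_ ->] := is_derive_affine (c * a ^+ n) df; rewrite exprSr; ring.
Qed.

Lemma smooth_affine f (c a b : R) : smooth f ->
  smooth (fun x => c * f (a * x + b)).
Proof.
move=> fs n x; rewrite derive1n_affine//.
have df := DeriveDef (fs n (a * x + b)) erefl.
by have [] := is_derive_affine (c * a ^+ n) df.
Qed.

Lemma derive1nB f g n : smooth f -> smooth g ->
  derive1n n (f \- g) = derive1n n f \- derive1n n g.
Proof.
move=> fs gs; elim: n => // n IH.
rewrite !derive1nS IH; apply/funext => x.
have [_] := is_deriveB (DeriveDef (fs n x) erefl) (DeriveDef (gs n x) erefl).
by rewrite /= !derive1E.
Qed.

Lemma smoothB f g : smooth f -> smooth g -> smooth (f \- g).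
Proof.
move=> fs gs n x; rewrite derive1nB//.
by apply: derivableB; [exact: fs|exact: gs].
Qed.

Lemma smooth_continuous f : smooth f -> continuous f.
Proof.
by move=> fs x; apply: differentiable_continuous; apply/derivable1_diffP/(fs 0).
Qed.

(** The complement of [K] is open, so around each of its points the function is locally zero, and so
    are its derivatives. *)
Lemma derive1n_eq0 f (K : set R) n : closed K -> (forall x, ~ K x -> f x = 0) ->
  forall x, ~ K x -> derive1n n f x = 0.
Proof.
move=> cK f0; elim: n => // n IH x Kx.
have h : is_derive x 1 (derive1n n f) 0.
  apply: (@near_eq_is_derive _ _ _ (cst 0)).
  have : nbhs x (~` K) by apply: open_nbhs_nbhs; split => //; exact: closed_openC.
  by apply: filterS => y /IH.
by rewrite derive1nS derive1E; have [_ ->] := h.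
Qed.

End smooth_functions.

Lemma flat_bounded (R : realType) (p : {poly R}) k :
  exists C, forall y, `|flat p k y| <= C.
Proof.
have [C pC] := flat_bound p k; exists C => y.
have C0 : 0 <= C.
  have := le_trans (normr_ge0 _) (pC 2^-1).
  by rewrite pmulr_lge0// exprn_gt0//; lra.
have [/andP[y0 y1]|y01] := boolP (0 < y < 1); last first.
  by rewrite /flat (negbTE y01) normr0.
rewrite (le_trans (pC y))// ler_piMr// exprn_ile1//; nra.
Qed.

(** The step is the primitive [F] of the bump [exp (- 1 / (x (1 - x)))], divided by its total mass
    [F 1]. *)
Lemma exists_smooth_step (R : realType) : exists s : R -> R,
  [/\ smooth s, forall x, 0 <= s x <= 1,
      (forall x, x <= 0 -> s x = 0) /\ (forall x, 1 <= x -> s x = 1),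
      forall x, ~~ (0 < x < 1) -> derive1 s x = 0 &
      exists2 M, 0 <= M & forall x, `|derive1 s x| <= M /\ `|derive1n 2 s x| <= M].
Proof.
pose mu := @lebesgue_measure R.
pose h : R -> R := flat 1 0.
have h_gt0 x : 0 < x < 1 -> 0 < h x.
  by move=> x01; rewrite /h /flat x01 hornerE mul1r invr1 mul1r expR_gt0.
have h0 x : ~~ (0 < x < 1) -> h x = 0 by rewrite /h /flat => /negbTE ->.
have h_ge0 x : 0 <= h x.
  by have [/h_gt0/ltW|/h0 ->] := boolP (0 < x < 1).
have hs : smooth h by move=> n x; exact: flat_smooth.
have hc := smooth_continuous hs.
(* On the half-line the bump is integrable because it is continuous and vanishes off [[0, 1]]. *)
have hint (a : R) : mu.-integrable `]-oo, a] (EFin \o h).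
  have hE : EFin \o h = (EFin \o h) \_ (`[0, 1]%classic : set R).
    apply/funext => x; rewrite patchE; case: ifPn => //= x01.
    rewrite h0//; apply: contra x01 => /andP[x0 x1].
    by rewrite inE/= in_itv/= (ltW x0) (ltW x1).
  apply: (@integrableS _ _ _ mu setT) => //.
  rewrite hE; apply/integrable_restrict => //; rewrite setTI.
  apply: continuous_compact_integrable; first exact: segment_compact.
  exact: continuous_subspaceT.
pose F x := \int[mu]_(t in `]-oo, x]) h t.
have dF (x : R) : is_derive x 1 F (h x).
  have [] := @continuous_FTC1 R h -oo%O x (x + 1) _ (hint _) _ (hc x); rewrite ?ltrDl//.
    by rewrite ltNyr.
  by move=> d <-; rewrite derive1E; apply: DeriveDef.
have Fc : continuous F.
  by move=> x; apply: differentiable_continuous; apply/derivable1_diffP; have [] := dF x.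
have FB x y : x <= y -> exists2 c, c \in `[x, y] & F y - F x = h c * (y - x).
  move=> xy; apply: (@MVT_segment R F h x y xy (fun z _ => dF z)).
  exact: continuous_subspaceT.
have F0 x : x <= 0 -> F x = 0.
  move=> x0; transitivity (\int[mu]_(t in `]-oo, x]) (cst 0 t : R)); last first.
    by rewrite Rintegral_cst// mul0r.
  apply: eq_Rintegral => t; rewrite inE/= in_itv/= => tx; apply: h0.
  by rewrite negb_and -leNgt (le_trans tx).
have F1 x : 1 <= x -> F x = F 1.
  move=> x1; apply/eqP; rewrite -subr_eq0; have [c + ->] := FB _ _ x1.
  by rewrite in_itv/= => /andP[c1 _]; rewrite h0 ?mul0r// negb_and -!leNgt c1 orbT.
have Fle x y : x <= y -> F x <= F y.
  move=> xy; rewrite -subr_ge0; have [c _ ->] := FB _ _ xy.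
  by rewrite mulr_ge0 ?subr_ge0.
(* By the mean value theorem [F 1 = h c] for some [c] strictly between [0] and [1], where the bump
   is positive. *)
have c0 : 0 < F 1.
  have [|c] := @MVT R F h 0 1 ltr01 (fun z _ => dF z).
    exact: continuous_subspaceT.
  by rewrite in_itv/= (F0 0)// !subr0 mulr1 => /h_gt0 + ->.
have V0 : 0 <= (F 1)^-1 by rewrite invr_ge0 ltW.
(* The form [1 * x + 0] makes the lemmas on affine substitutions apply. *)
pose s x := (F 1)^-1 * F (1 * x + 0).
have ds : derive1 s = (fun x => (F 1)^-1 * h (1 * x + 0)).
  apply/funext => x; rewrite derive1E.
  by have [_ ->] := is_derive_affine (F 1)^-1 (dF (1 * x + 0)); rewrite mulr1.
exists s; split.
- move=> [|n] x; last by rewrite derive1Sn ds; exact: smooth_affine.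
  by have [] := is_derive_affine (F 1)^-1 (dF (1 * x + 0)).
- move=> x; rewrite /s mul1r addr0; apply/andP; split.
    rewrite mulr_ge0//.
    have [x0|/ltW x0] := leP x 0; first by rewrite F0.
    by rewrite -(F0 0)// Fle.
  rewrite mulrC ler_pdivrMr// mul1r.
  by have [x1|/ltW x1] := leP 1 x; [rewrite F1|exact: Fle].
- split => x x1; rewrite /s mul1r addr0.
    by rewrite (F0 _ x1) mulr0.
  by rewrite (F1 _ x1) mulVf// gt_eqF.
- by move=> x x01; rewrite ds mul1r addr0 h0 ?mulr0.
(* Up to the factor [(F 1)^-1], [s'] is the bump and [s''] its derivative, again a [flat] function;
   the sum of the two bounds serves for both. *)
have [C1 hC1] := flat_bounded (1 : {poly R}) 0.
have [C2 hC2] := flat_bounded (dflat (1 : {poly R}) 0) 2.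
have m1 := normr_ge0 C1; have m2 := normr_ge0 C2.
exists ((F 1)^-1 * (`|C1| + `|C2|)).
  by rewrite mulr_ge0 ?addr_ge0.
move=> x; rewrite derive1Sn ds; split.
  rewrite normrM (ger0_norm V0) ler_wpM2l//.
  by rewrite (le_trans (hC1 _))// (le_trans (ler_norm _))// lerDl.
rewrite (derive1n_affine _ _ _ 1 hs) expr1n mulr1 [derive1n 1 h]derive1_flat.
rewrite normrM (ger0_norm V0) ler_wpM2l//.
by rewrite (le_trans (hC2 _))// (le_trans (ler_norm _))// lerDr.
Qed.

(** The powers of [q - p] are those produced by rescaling one fixed step to the interval from [p] to
    [q], so that a single [M] serves all intervals. *)
Definition smooth_step (R : realType) (M p q : R) (s : R -> R) :=
  [/\ smooth s, forall x, 0 <= s x <= 1,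
      (forall x, x <= p -> s x = 0) /\ (forall x, q <= x -> s x = 1),
      forall x, ~~ (p < x < q) -> derive1 s x = 0 &
      forall x, `|derive1 s x| <= M / (q - p) /\
                `|derive1n 2 s x| <= M / (q - p) ^+ 2].

Lemma exists_smooth_step_itv (R : realType) :
  exists2 M : R, 0 <= M & forall p q, p < q -> exists s, smooth_step M p q s.
Proof.
have [s [ss s01 [s0 s1] ds0 [M M0 sM]]] := exists_smooth_step R.
exists M => // p q pq.
have pq0 : 0 < q - p by rewrite subr_gt0.
pose a := (q - p)^-1; pose b := - (a * p).
have a0 : 0 < a by rewrite invr_gt0.
have abp x : a * x + b = (x - p) / (q - p) by rewrite /b /a; ring.
exists (fun x => 1 * s (a * x + b)); split.
- exact: smooth_affine.
- by move=> x; rewrite mul1r.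
- split=> x xpq; rewrite mul1r abp.
    by rewrite s0// pmulr_lle0// subr_le0.
  by rewrite s1// ler_pdivlMr// mul1r lerB.
- move=> x xpq; rewrite -derive1n1 derive1n_affine// derive1n1 ds0 ?mulr0//.
  by rewrite abp pmulr_lgt0// ltr_pdivrMr// mul1r subr_gt0 ltrD2r.
- move=> x; rewrite -(@derive1n1 _ _ (fun x => _)) !derive1n_affine//.
  rewrite !mul1r !normrM !normrX (gtr0_norm a0) -exprVn -/a expr1 derive1n1.
  have [b1 b2] := sM (a * x + b).
  have a0' := ltW a0.
  by split; rewrite mulrC ler_wpM2r// mulr_ge0.
Qed.

Lemma integral_derive1_smooth_step (R : realType) (M p q : R) s : p < q ->
  smooth_step M p q s ->
  \int[lebesgue_measure]_(x in `]p, q[) derive1 s x = 1.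
Proof.
move=> pq [ss _ [s0 s1] _ _].
have sc := smooth_continuous (@smooth_derive1n _ _ 1 ss).
rewrite /Rintegral -(@integral_itv_bndoo _ p q _ true false); last first.
  by apply/measurable_EFinP; apply: measurable_funTS; exact: continuous_measurable_fun.
rewrite (@continuous_FTC2 _ _ s)//=.
- by rewrite (s0 p)// (s1 q)// subr0.
- exact: continuous_subspaceT.
- split; first by move=> x _; exact: (ss 0).
  + exact/cvg_at_right_filter/(smooth_continuous ss).
  + exact/cvg_at_left_filter/(smooth_continuous ss).
Qed.

(** * Integration against compactly supported functions and restriction of weak derivatives *)

Lemma integrable_mul_compact_support (R : realType) (D K : set R) (g phi : R -> R) :
  locally_integrable D g -> continuous phi -> compact K -> K `<=` D ->
  (forall x, ~ K x -> phi x = 0) ->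
  lebesgue_measure.-integrable D (EFin \o (fun x => g x * phi x)).
Proof.
move=> [mg oD lg] cphi cK KD phi0.
have mK := compact_measurable cK; have mD := open_measurable oD.
have -> : EFin \o (fun x => g x * phi x) = (EFin \o (fun x => g x * phi x)) \_ K.
  apply/funext => x; rewrite patchE; case: ifPn => //= xK.
  by rewrite phi0 ?mulr0//; move/negP: xK; apply: contra_not => /mem_set.
apply/integrable_restrict => //; rewrite setIidr//.
rewrite (_ : _ \o _ = ((EFin \o g) \* (EFin \o phi))%E)//.
apply: integrableMl => //.
- apply/integrableP; split; last exact: lg.
  by apply/measurable_EFinP; exact: measurable_funS mg.
- by apply: measurable_funTS; exact: continuous_measurable_fun.
- have [N [Nr NP]] : bounded_set (phi @` K).
    by apply: compact_bounded; apply: continuous_compact => //; exact: continuous_subspaceT.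
  by exists N; split => // y Ny x Kx; apply: (NP _ Ny); exists x.
Qed.

(** A test function on [D'] is one on [D], and since it and its derivatives vanish off a compact [K]
    inside [D'], the integrals over [D] and [D'] coincide. *)
Lemma weak_derivativeS (R : realType) (D D' : set R) j u v :
  open D' -> D' `<=` D -> weak_derivative D j u v -> weak_derivative D' j u v.
Proof.
move=> oD' DD' [lu lv uv].
have mD' := open_measurable oD'.
have lS f : locally_integrable D f -> locally_integrable D' f.
  move=> [mf oD lf]; split => //.
    by apply: measurable_funS mf => //; exact: open_measurable.
  by move=> K KD'; apply: lf; exact: subset_trans DD'.
split; [exact: lS|exact: lS|move=> phi [sphi [K [cK KD' phi0]]]].
have IS w psi : (forall x, ~ K x -> psi x = 0) ->
  \int[lebesgue_measure]_(x in D) (w x * psi x) =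
  \int[lebesgue_measure]_(x in D') (w x * psi x).
  move=> psi0; rewrite Rintegral_mkcond [RHS]Rintegral_mkcond.
  congr Rintegral; apply/funext => x; rewrite !patchE.
  have [xK|xK] := pselect (K x).
    by rewrite !mem_set//; [exact: KD'|exact/DD'/KD'].
  by rewrite psi0// mulr0 !if_same.
have := uv phi; rewrite !IS//; last first.
  apply: derive1n_eq0 => //; apply: compact_closed => //; exact: Rhausdorff.
by apply; split => //; exists K; split => //; exact: subset_trans DD'.
Qed.

(** * Pointwise bound at Lebesgue points *)

Lemma normr_Rintegral_mul_le (d : measure_display) (T : measurableType d)
    (R : realType) (mu : {measure set T -> \bar R}) (D : set T) (w psi : T -> R)
    (C : R) :
  measurable D -> mu.-integrable D (EFin \o w) ->
  mu.-integrable D (EFin \o (fun x => w x * psi x)) ->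
  (forall x, D x -> `|psi x| <= C) ->
  `|\int[mu]_(x in D) (w x * psi x)| <= C * \int[mu]_(x in D) `|w x|.
Proof.
move=> mD iw iwp psiC; rewrite (le_trans (le_normr_Rintegral mD iwp))//.
have iw' := integrable_norm iw.
rewrite -RintegralZl//; apply: le_Rintegral => //.
- exact: integrable_norm iwp.
- exact: integrableZl iw'.
- by move=> x Dx; rewrite normrM mulrC ler_wpM2r// psiC.
Qed.

Section pointwise.
Context {R : realType}.
Local Notation mu := (@lebesgue_measure R).

(** The function [s'] has integral [1] and is at most [M / e], so the error is at most [M / e] times
    the integral of [|G x - G p|] over the ball of radius [e], that is [2 M] times a mean
    oscillation that tends to [0] at a Lebesgue point. *)
Lemma lebesgue_pt_smooth_step (G : R -> R) (p M eta : R) :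
  locally_integrable setT G -> lebesgue_pt G p -> 0 <= M -> 0 < eta ->
  exists2 e0, 0 < e0 & forall e s, 0 < e < e0 -> smooth_step M p (p + e) s ->
  `|\int[mu]_(x in `]p, p + e[) (G x * derive1 s x) - G p| <= eta.
Proof.
move=> [mG _ lG] Gp M0 eta0.
(* A mean oscillation below [eta / (2 M + 1)] suffices; the [1] keeps the denominator positive when
   [M = 0]. *)
have M1 : 0 < 2 * M + 1 by rewrite ltr_wpDl// mulr_ge0.
have /fine_cvgP[fin /cvgr0_norm_lt/(_ (eta / (2 * M + 1)))] := Gp.
rewrite divr_gt0// => /(_ isT); rewrite near_withinE => davg_lt.
have [e0 /= e00 He] : exists2 e0 : R, 0 < e0 & forall e, 0 < e < e0 ->
    davg G p e \is a fin_num /\ fine (davg G p e) < eta / (2 * M + 1).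
  have : \forall e \near (0 : R), 0 < e -> davg G p e \is a fin_num /\
       fine (davg G p e) < eta / (2 * M + 1).
    move: fin; rewrite near_withinE; move: davg_lt; apply: filterS2 => e h1 h2 e0'.
    by split; [exact: h2|exact: le_lt_trans (ler_norm _) (h1 e0')].
  move=> /nbhs_ballP[e0 /= e00 He]; exists e0 => // e /andP[e0' ee0].
  by apply: He => //; rewrite /ball/= sub0r normrN gtr0_norm.
exists e0 => // e s ee0 ss; have [fe de] := He e ee0.
have /andP[e_gt0 _] := ee0.
have [s1 _ _ s0 sM] := ss.
have pe : p < p + e by rewrite ltrDl.
have iG : mu.-integrable `[p - e, p + e] (EFin \o G).
  apply/integrableP; split; last by apply: lG => //; exact: segment_compact.
  by apply/measurable_EFinP; exact: measurable_funTS.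
have iGp : mu.-integrable (ball p e) (EFin \o (fun x => G x - G p)).
  apply: (@integrableS _ _ _ mu `[p - e, p + e]) => //; first exact: measurable_ball.
    by rewrite ball_itv; exact: subset_itv_oo_cc.
  apply: (@integrableB _ _ _ mu _ _ (EFin \o G) (EFin \o cst (G p))) => //.
  apply: continuous_compact_integrable; first exact: segment_compact.
  by apply: continuous_subspaceT; exact: cst_continuous.
have sub : `]p, p + e[ `<=` ball p e.
  rewrite ball_itv; apply: subset_itvr; rewrite bnd_simp.
  by rewrite lerBlDr lerDl ltW.
have iGp' : mu.-integrable `]p, p + e[ (EFin \o (fun x => G x - G p)).
  by apply: integrableS iGp => //; exact: measurable_ball.
have iG' : mu.-integrable `]p, p + e[ (EFin \o G).
  apply: integrableS iG => //; apply: subset_trans sub _.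
  by rewrite ball_itv; exact: subset_itv_oo_cc.
have scont := smooth_continuous (@smooth_derive1n _ _ 1 s1).
have ms : measurable_fun `]p, p + e[ (derive1 s).
  by apply: measurable_funTS; exact: continuous_measurable_fun.
have bs : [bounded derive1 s x | x in `]p, p + e[].
  exists (M / (p + e - p)); split; first exact: num_real.
  by move=> y My x _; have [+ _] := sM x; move=> /le_trans; apply; exact: ltW.
have is1 : mu.-integrable `]p, p + e[ (EFin \o (fun x => (G x - G p) * derive1 s x)).
  exact: (integrableMl _ iGp' ms bs).
have is2 : mu.-integrable `]p, p + e[ (EFin \o derive1 s).
  apply: measurable_bounded_integrable => //.
  by rewrite /= lebesgue_measure_itv/= lte_fin pe -EFinB ltry.
(* Since [s'] integrates to [1], the constant [G p] can be moved under the integral. *)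
have -> : \int[mu]_(x in `]p, p + e[) (G x * derive1 s x) - G p =
    \int[mu]_(x in `]p, p + e[) ((G x - G p) * derive1 s x).
  rewrite -[X in _ - X]mulr1 -(integral_derive1_smooth_step pe ss).
  rewrite -RintegralZl// -RintegralB//.
  - by apply: eq_Rintegral => x _; rewrite mulrBl.
  - exact: (integrableMl _ iG' ms bs).
  - exact: (integrableZl _ _ is2).
apply: le_trans (normr_Rintegral_mul_le (C := M / e) _ iGp' is1 _) _ => //.
  by move=> x _; have [+ _] := sM x; rewrite addrAC subrr add0r.
have le1 : \int[mu]_(x in `]p, p + e[) `|G x - G p| <=
    \int[mu]_(x in ball p e) `|G x - G p|.
  have i1 := integrable_norm iGp; have i2 := integrable_norm iGp'.
  have mb := measurable_ball p e.
  rewrite /Rintegral fine_le ?integrable_fin_num//.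
  by apply: ge0_subset_integral => //; have /integrableP[] := i1.
have davgE : \int[mu]_(x in ball p e) `|G x - G p| = 2 * e * fine (davg G p e).
  rewrite /davg /iavg lebesgue_measure_ball ?(ltW e_gt0)//.
  have e2 : e *+ 2 != 0 by rewrite mulrn_eq0/= gt_eqF.
  rewrite inver (negbTE e2) fineM//; last first.
    apply: integrable_fin_num; first exact: measurable_ball.
    exact: integrable_norm iGp.
  by rewrite /Rintegral mulrA/= (_ : 2 * e = e *+ 2) ?mulfV ?mul1r// mulr_natl.
rewrite (le_trans (ler_wpM2l _ le1))//; first by rewrite divr_ge0// ltW.
have d0 : 0 <= fine (davg G p e) by rewrite fine_ge0// davg_ge0.
move: d0 de; rewrite davgE ltr_pdivlMr//; set D := fine _ => d0 de.
have -> : M / e * (2 * e * D) = 2 * M * D by field; rewrite gt_eqF.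
nra.
Qed.

End pointwise.

(** The test function is [T - S], with [T] a step just to the right of [p] and [S] a step across the
    middle third of the interval; that third is the source of the [9]. Cutting [g] down to
    [[c', d']] makes it locally integrable on the whole line, as the Lebesgue point argument
    requires. *)
Lemma weak_derivative_pointwise_bound (R : realType) (M c d : R) (f g h : R -> R)
    (c' p d' : R) : 0 <= M ->
  (forall p q : R, p < q -> exists s, smooth_step M p q s) ->
  weak_derivative `]c, d[ 1 f g -> weak_derivative `]c, d[ 1 g h ->
  lebesgue_measure.-integrable `]c, d[ (EFin \o f) ->
  lebesgue_measure.-integrable `]c, d[ (EFin \o h) ->
  c < c' -> c' < p -> p < d' -> d' < d ->
  lebesgue_pt (g \_ `[c', d']) p ->
  `|g p| <= 9 * M / (d - c) ^+ 2 * \int[lebesgue_measure]_(x in `]c, d[) `|f x|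
            + \int[lebesgue_measure]_(x in `]c, d[) `|h x|.
Proof.
move=> M0 steps [lf lg fg] [_ lh gh] fi hi cc' c'p pd' d'd gp.
set J : set R := `]c, d[%classic.
have mJ : measurable (J : set (measurableTypeR R)) by exact: measurable_itv.
have cd : c < d by lra.
have dist01 (s t : R) : 0 <= s <= 1 -> 0 <= t <= 1 -> `|s - t| <= 1.
  by move=> /andP[? ?] /andP[? ?]; rewrite ler_norml; apply/andP; split; lra.
have lG : locally_integrable setT (g \_ `[c', d']).
  apply: integrable_locally_restrict => //.
  apply/integrableP; case: lg => mg oD lg; split.
    by apply/measurable_EFinP; apply: measurable_funS mg => //; exact: subset_itv.
  apply: lg; last exact: segment_compact.
  by apply: subset_itv; rewrite bnd_simp.
apply/ler_addgt0Pr => eta eta0.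
have [e0 e00 He] := lebesgue_pt_smooth_step lG gp M0 eta0.
(* This [e] is below the threshold [e0] and keeps [p + e] below [d']. *)
pose e := Num.min (e0 / 2) ((d' - p) / 2).
have e_gt0 : 0 < e by rewrite lt_min !divr_gt0// subr_gt0.
have ee0 : e < e0 by rewrite gt_min ltr_pdivrMr// mulr2n mulrDr mulr1 ltrDl e00.
have ed : p + e < d'.
  rewrite -ltrBrDl gt_min; apply/orP; right; lra.
have pe : p < p + e by rewrite ltrDl.
have [T sT] := steps _ _ pe.
have r0 : 0 < d - c by rewrite subr_gt0.
have ME : M / (c + (d - c) / 3 * 2 - (c + (d - c) / 3)) ^+ 2 = 9 * M / (d - c) ^+ 2.
  move: (d - c) r0 => r r0.
  have -> : c + r / 3 * 2 - (c + r / 3) = r / 3 by field.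
  by field; rewrite gt_eqF.
have [S sS] : exists s, smooth_step M (c + (d - c) / 3) (c + (d - c) / 3 * 2) s.
  by apply: steps; lra.
have [sT1 T01 [T0 T1] dT0 _] := sT.
have [sS1 S01 [S0 S1] dS0 dSM] := sS.
have gE : \int[lebesgue_measure]_(x in `]p, p + e[) ((g \_ `[c', d']) x * derive1 T x)
    = \int[lebesgue_measure]_(x in J) (g x * derive1 T x).
  rewrite Rintegral_mkcond [RHS]Rintegral_mkcond; congr Rintegral.
  apply/funext => x; rewrite !patchE.
  have [xpe|xpe] := boolP (p < x < p + e); last first.
    by rewrite dT0// !mulr0 !if_same.
  move: xpe => /andP[px xe].
  have xJ : J x by rewrite /J/= in_itv/=; apply/andP; split; lra.
  have xc : `[c', d']%classic x by rewrite /= in_itv/=; apply/andP; split; lra.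
  have xp : `]p, p + e[%classic x by rewrite /= in_itv/= px xe.
  by rewrite !mem_set.
(* [K] covers both transitions: to its left [T] and [S] are both [0], to its right both [1], so
   their difference vanishes off [K]. *)
pose K : set R := `[Num.min p (c + (d - c) / 3), Num.max (p + e) (c + (d - c) / 3 * 2)]%classic.
have KJ : K `<=` J.
  apply: subset_itv; rewrite bnd_simp.
    by rewrite lt_min; apply/andP; split; lra.
  by rewrite gt_max; apply/andP; split; lra.
have cK : compact K by exact: segment_compact.
have clK : closed K by apply: compact_closed => //; exact: Rhausdorff.
have K_out x : ~ K x -> (x <= p /\ x <= c + (d - c) / 3) \/
    (p + e <= x /\ c + (d - c) / 3 * 2 <= x).
  move=> /negP; rewrite /K/= in_itv/= negb_and -!ltNge lt_min gt_max.
  by move=> /orP[|] /andP[] /ltW ? /ltW ?; [left|right].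
pose phi := T \- S.
have phi0 x : ~ K x -> phi x = 0.
  move=> /K_out[[h1 h2]|[h1 h2]]; rewrite /phi/=.
    by rewrite (T0 _ h1) (S0 _ h2) subrr.
  by rewrite (T1 _ h1) (S1 _ h2) subrr.
have sphi : smooth phi by exact: smoothB.
have dS0K x : ~ K x -> derive1 S x = 0.
  by move=> /K_out[[h1 h2]|[h1 h2]]; apply: dS0; rewrite negb_and -!leNgt h2 ?orbT.
have dT0K x : ~ K x -> derive1 T x = 0.
  by move=> /K_out[[h1 h2]|[h1 h2]]; apply: dT0; rewrite negb_and -!leNgt h1 ?orbT.
have tphi : test_function J phi by split => //; exists K.
have tdS : test_function J (derive1 S).
  by split; [exact: (@smooth_derive1n _ _ 1)|exists K].
have IK w psi : locally_integrable J w -> smooth psi -> (forall x, ~ K x -> psi x = 0) ->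
    lebesgue_measure.-integrable J (EFin \o (fun x => w x * psi x)).
  by move=> lw spsi psi0; apply: (integrable_mul_compact_support lw _ cK) => //;
    exact: smooth_continuous.
have sdT := @smooth_derive1n _ _ 1 sT1.
have sdS := @smooth_derive1n _ _ 1 sS1.
have sd2 : smooth (derive1n 2 S) by exact: (@smooth_derive1n R S 2 sS1).
have d20 x : ~ K x -> derive1n 2 S x = 0.
  by rewrite derive1Sn; exact: (@derive1n_eq0 R (derive1 S) K 1 clK dS0K x).
(* Here the weak derivative [h] of [g] is tested against [T - S]. *)
have ghE : \int[lebesgue_measure]_(x in J) (g x * derive1 T x) =
    \int[lebesgue_measure]_(x in J) (g x * derive1 S x)
    - \int[lebesgue_measure]_(x in J) (h x * phi x).
  apply/eqP; rewrite addrC -subr_eq; apply/eqP.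
  have := gh _ tphi; rewrite expr1 mulN1r => <-.
  rewrite -(RintegralB mJ (IK _ _ lg sdT dT0K) (IK _ _ lg sdS dS0K)).
  by apply: eq_Rintegral => x _; rewrite derive1nB// -mulrBr.
(* Here the weak derivative [g] of [f] is tested against [S'], which is itself a test function. *)
have fgE : \int[lebesgue_measure]_(x in J) (g x * derive1 S x) =
    - \int[lebesgue_measure]_(x in J) (f x * derive1n 2 S x).
  have := fg _ tdS; rewrite expr1 mulN1r -derive1Sn => /(congr1 -%R).
  by rewrite opprK => <-.
have b1 : `|\int[lebesgue_measure]_(x in J) (f x * derive1n 2 S x)| <=
    9 * M / (d - c) ^+ 2 * \int[lebesgue_measure]_(x in J) `|f x|.
  apply: (normr_Rintegral_mul_le mJ fi (IK _ _ lf sd2 d20)).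
  move=> x _; have [_] := dSM x; move=> /le_trans; apply.
  by rewrite ME.
have b2 : `|\int[lebesgue_measure]_(x in J) (h x * phi x)| <=
    1 * \int[lebesgue_measure]_(x in J) `|h x|.
  apply: (normr_Rintegral_mul_le mJ hi (IK _ _ lh sphi phi0)).
  by move=> x _; exact: dist01.
have := He e T; rewrite e_gt0 ee0 gE ghE fgE => /(_ isT sT).
rewrite patchE mem_set/=; last by rewrite in_itv/= !ltW.
move: b1 b2; rewrite mul1r.
set A := \int[lebesgue_measure]_(x in J) (f x * derive1n 2 S x).
set B := \int[lebesgue_measure]_(x in J) (h x * phi x).
move=> b1 b2 b3.
(* By the two identities [- A - B] is the integral of [g T'], so the parenthesis is the error
   controlled by [eta]. *)
have -> : g p = - (- A - B - g p) - A - B by ring.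
rewrite [leRHS]addrC addrA.
apply: le_trans (ler_normB _ _) _; apply: lerD b2.
by apply: le_trans (ler_normB _ _) _; rewrite normrN; exact: lerD.
Qed.

(** * Interpolation between consecutive derivatives *)

(** Since [|y| <= y ^ 2 + 1], a constant is integrable on a set of finite measure and the comparison
    concludes. *)
Lemma integrable_of_sqr (d : measure_display) (T : measurableType d)
    (R : realType) (mu : {measure set T -> \bar R}) (D : set T) (f : T -> R) :
  measurable D -> (mu D < +oo)%E -> measurable_fun D f ->
  mu.-integrable D (EFin \o (fun x => f x ^+ 2)) -> mu.-integrable D (EFin \o f).
Proof.
move=> mD Dfin mf if2.
have i1 : mu.-integrable D (EFin \o cst 1).
  apply: measurable_bounded_integrable => //.
  by exists 1; split => // y y1 x _; rewrite /= normr1 ltW.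
apply: (le_integrable mD _ _ (integrableD mD if2 i1)).
  exact/measurable_EFinP.
move=> x _; rewrite /= lee_fin [leRHS]ger0_norm ?addr_ge0 ?sqr_ge0//.
rewrite -[f x ^+ 2]real_normK ?num_real//.
by move: (`|f x|); clear => y; have := sqr_ge0 (y - 2^-1); nra.
Qed.

(** Cauchy-Schwarz against the constant [1], obtained by integrating [2 m |f| <= f ^ 2 + m ^ 2] with
    [m] the mean of [|f|]. *)
Lemma sqr_Rintegral_le (d : measure_display) (T : measurableType d)
    (R : realType) (mu : {measure set T -> \bar R}) (D : set T) (f : T -> R) :
  measurable D -> (mu D < +oo)%E -> 0 < fine (mu D) ->
  measurable_fun D f -> mu.-integrable D (EFin \o (fun x => f x ^+ 2)) ->
  (\int[mu]_(x in D) `|f x|) ^+ 2 <= fine (mu D) * \int[mu]_(x in D) (f x ^+ 2).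
Proof.
move=> mD Dfin V0 mf if2; set V := fine _ in V0 *; set A := Rintegral _ _ _.
set Q := Rintegral _ _ _.
pose m := A / V.
have i1 := integrable_norm (integrable_of_sqr mD Dfin mf if2).
have im : mu.-integrable D (EFin \o cst (m ^+ 2)).
  apply: measurable_bounded_integrable => //.
  exists (m ^+ 2); split; first exact: num_real.
  by move=> y y1 x _; rewrite /= ger0_norm ?sqr_ge0// ltW.
have AQ : (2 * m) * A <= Q + m ^+ 2 * V.
  rewrite /A /Q /V -(Rintegral_cst mu mD) -RintegralZl// -RintegralD//.
  apply: le_Rintegral => //.
  - exact: integrableZl i1.
  - exact: integrableD if2 im.
  - move=> x _; rewrite -[X in _ <= X + _]real_normK ?num_real//.
    have := sqr_ge0 (`|f x| - m); rewrite sqrrB; move: `|f x| (m); clear => y m.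
    by rewrite -mulr_natl => h; lra.
have AE : A = m * V by rewrite /m divfK ?gt_eqF.
move: AQ V0; rewrite AE; move: (m) (V) (Q); clear => m V Q AQ V0.
by rewrite exprMn expr2; nra.
Qed.

Lemma local_interpolation (R : realType) : exists2 C : R, 0 < C &
  forall (c d : R) (f g h : R -> R), c < d ->
  weak_derivative `]c, d[ 1 f g -> weak_derivative `]c, d[ 1 g h ->
  (\int[lebesgue_measure]_(x in `]c, d[) (g x ^+ 2)%:E <=
   \int[lebesgue_measure]_(x in `]c, d[)
     (C * ((d - c) ^- 2 * f x ^+ 2 + (d - c) ^+ 2 * h x ^+ 2))%:E)%E.
Proof.
have [M M0 steps] := exists_smooth_step_itv R.
(* [162 = 2 * 9 ^ 2]: the pointwise bound is squared by [(x + y)^2 <= 2 (x^2 + y^2)]. *)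
exists (162 * M ^+ 2 + 2); first by rewrite ltr_wpDl// mulr_ge0// sqr_ge0.
set C := _ + 2; have C2 : 2 <= C by rewrite lerDr mulr_ge0// sqr_ge0.
have C0 : 0 <= C by exact: le_trans C2.
move=> c d f g h cd fg gh.
have r0 : 0 < d - c by rewrite subr_gt0.
set r := d - c in r0 *; pose J : set R := `]c, d[%classic.
have mJ : measurable (J : set (measurableTypeR R)) by exact: measurable_itv.
have muJ : lebesgue_measure J = r%:E by rewrite lebesgue_measure_itv/= lte_fin cd.
have mf : measurable_fun J f by case: fg => -[].
have mg : measurable_fun J g by case: gh => -[].
have mh : measurable_fun J h by case: gh => _ [].
pose F x := C * (r ^- 2 * f x ^+ 2 + r ^+ 2 * h x ^+ 2).
have V2 : 0 <= r ^- 2 by rewrite invr_ge0 sqr_ge0.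
have F0 x : 0 <= F x by rewrite mulr_ge0 ?addr_ge0// mulr_ge0 ?sqr_ge0.
have mF : measurable_fun J F.
  by apply: measurable_funM => //; apply: measurable_funD; apply: measurable_funM => //;
  exact: measurable_funX.
have [->|Ffin] := eqVneq (\int[lebesgue_measure]_(x in J) (F x)%:E)%E +oo%E.
  exact: leey.
have iF : lebesgue_measure.-integrable J (EFin \o F).
  apply/integrableP; split; first exact/measurable_EFinP.
  under eq_integral do rewrite /= ger0_norm//.
  by rewrite ltey.
have Fbound (x y : R) : C * (x ^+ 2 + y ^+ 2) >= x ^+ 2.
  by have := sqr_ge0 x; have := sqr_ge0 y; move: (C) C2; clear => C C2 ? ?; nra.
have if2 : lebesgue_measure.-integrable J (EFin \o (fun x => f x ^+ 2)).
  apply: (le_integrable mJ _ _ (integrableZl mJ (r ^+ 2) iF)).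
    by apply/measurable_EFinP; exact: measurable_funX.
  move=> x _; rewrite /= lee_fin !ger0_norm ?sqr_ge0//; last first.
    by apply: mulr_ge0 => //; exact: sqr_ge0.
  have -> : r ^+ 2 * F x = C * (f x ^+ 2 + (r ^+ 2 * h x) ^+ 2).
    rewrite /F; move: (f x) (h x) (C) (r) r0; clear => u v C r r0.
    by field; rewrite gt_eqF.
  exact: Fbound.
have ih2 : lebesgue_measure.-integrable J (EFin \o (fun x => h x ^+ 2)).
  apply: (le_integrable mJ _ _ (integrableZl mJ (r ^- 2) iF)).
    by apply/measurable_EFinP; exact: measurable_funX.
  move=> x _; rewrite /= lee_fin !ger0_norm ?sqr_ge0//; last first.
    by apply: mulr_ge0 => //; exact: sqr_ge0.
  have -> : r ^- 2 * F x = C * (h x ^+ 2 + (r ^- 2 * f x) ^+ 2).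
    rewrite /F; move: (f x) (h x) (C) (r) r0; clear => u v C r r0.
    by field; rewrite gt_eqF.
  exact: Fbound.
have Jfin : (lebesgue_measure J < +oo)%E by rewrite muJ ltry.
have if1 := integrable_of_sqr mJ Jfin mf if2.
have ih1 := integrable_of_sqr mJ Jfin mh ih2.
have V0 : 0 < fine (lebesgue_measure J) by rewrite muJ.
have csf := sqr_Rintegral_le mJ Jfin V0 mf if2.
have csh := sqr_Rintegral_le mJ Jfin V0 mh ih2.
have fmuJ : fine (lebesgue_measure J) = r by rewrite muJ.
rewrite [fine _]fmuJ in csf; rewrite [fine _]fmuJ in csh.
set A := (\int[lebesgue_measure]_(x in J) `|f x|) in csf.
set H := (\int[lebesgue_measure]_(x in J) `|h x|) in csh.
pose B := 9 * M / r ^+ 2 * A + H.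
(* [J] is exhausted by closed intervals indexed by [n]. Almost every [p] is a Lebesgue point of all
   the truncations of [g] at once, and [n] is then taken large enough for [p] to be interior to its
   interval. *)
have gB : {ae lebesgue_measure, forall p, J p -> `|g p| <= B}.
  have cds n : `[c + n.+1%:R^-1, d - n.+1%:R^-1] `<=` J.
    apply: subset_itv; rewrite bnd_simp; first by rewrite ltrDl invr_gt0.
    by rewrite ltrBlDr ltrDl invr_gt0.
  have key n : {ae lebesgue_measure, forall p,
      lebesgue_pt (g \_ `[c + n.+1%:R^-1, d - n.+1%:R^-1]) p}.
    apply: lebesgue_differentiation; apply: integrable_locally_restrict => //.
    case: gh => -[_ oJ lg] _ _; apply/integrableP; split.
      by apply/measurable_EFinP; apply: measurable_funS mg.
    by apply: lg => //; exact: segment_compact.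
  have := ae_foralln key; apply: filterS => p /= gp; rewrite /J/= in_itv/= => /andP[cp pd].
  have [n ncp] : exists n, n.+1%:R^-1 < Num.min (p - c) (d - p).
    have m0 : 0 < Num.min (p - c) (d - p) by rewrite lt_min !subr_gt0 cp.
    exists (Num.truncn (Num.min (p - c) (d - p))^-1).
    by rewrite invf_plt ?posrE//; exact: truncnS_gt.
  move: ncp; rewrite lt_min => /andP[n1 n2].
  have n0 : 0 < n.+1%:R^-1 :> R by rewrite invr_gt0.
  apply: (weak_derivative_pointwise_bound M0 steps fg gh if1 ih1 _ _ _ _ (gp n)).
  - by rewrite ltrDl.
  - by rewrite -ltrBrDl.
  - by rewrite ltrBrDl -ltrBrDr.
  - by rewrite ltrBlDr ltrDl.
have gle : (\int[lebesgue_measure]_(x in J) (g x ^+ 2)%:E <=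
            \int[lebesgue_measure]_(x in J) (cst (B ^+ 2)%:E) x)%E.
  apply: ae_ge0_le_integral => //.
  - by move=> x _; rewrite lee_fin sqr_ge0.
  - by apply/measurable_EFinP; exact: measurable_funX.
  - by move=> x _; rewrite lee_fin sqr_ge0.
  - move: gB; apply: filterS; first exact: (ae_filter_ringOfSetsType lebesgue_measure).
    move=> x gB Jx; rewrite lee_fin -real_normK ?num_real//.
    by rewrite ler_sqr ?nnegrE// ?gB// (le_trans _ (gB Jx)).
apply: (le_trans gle).
have -> : (\int[lebesgue_measure]_(x in J) (cst (B ^+ 2)%:E) x)%E = (B ^+ 2 * r)%:E.
  by rewrite integral_cst// [RHS]EFinM -muJ.
set Qf := Rintegral _ _ _ in csf; set Qh := Rintegral _ _ _ in csh.
have -> : (\int[lebesgue_measure]_(x in J) (F x)%:E)%E = (C * (r ^- 2 * Qf + r ^+ 2 * Qh))%:E.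
  rewrite -[LHS]fineK; last exact: integrable_fin_num iF.
  congr EFin; rewrite -/(Rintegral _ _ _) /Qf /Qh.
  have e1 := integrableZl mJ (r ^- 2) if2; have e2 := integrableZl mJ (r ^+ 2) ih2.
  rewrite -!(RintegralZl _ mJ)// -(RintegralD mJ e1 e2).
  rewrite -(RintegralZl _ mJ)//.
  exact: (integrableD mJ e1 e2).
rewrite lee_fin.
move: csf csh r0; rewrite /B /C; move: (A) (H) (Qf) (Qh) (r) (M) M0; clear.
move=> A H Qf Qh r M M0 csf csh r0.
have B2 : (9 * M / r ^+ 2 * A + H) ^+ 2 <=
    2 * (81 * M ^+ 2 / r ^+ 4 * A ^+ 2) + 2 * H ^+ 2.
  have -> : 81 * M ^+ 2 / r ^+ 4 * A ^+ 2 = (9 * M / r ^+ 2 * A) ^+ 2.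
    by field; rewrite gt_eqF.
  by move: (9 * M / r ^+ 2 * A); clear => x; have := sqr_ge0 (x - H); nra.
have h1 : 81 * M ^+ 2 / r ^+ 4 * A ^+ 2 <= 81 * M ^+ 2 / r ^+ 3 * Qf.
  have -> : 81 * M ^+ 2 / r ^+ 3 * Qf = 81 * M ^+ 2 / r ^+ 4 * (r * Qf).
    by field; rewrite gt_eqF.
  rewrite ler_wpM2l//; apply: mulr_ge0; first by apply: mulr_ge0 => //; exact: sqr_ge0.
  by rewrite invr_ge0 exprn_ge0// ltW.
have Qf0 : 0 <= Qf by rewrite -(pmulr_rge0 _ r0) (le_trans _ csf)// sqr_ge0.
have Qh0 : 0 <= Qh by rewrite -(pmulr_rge0 _ r0) (le_trans _ csh)// sqr_ge0.
apply: (@le_trans _ _ ((2 * (81 * M ^+ 2 / r ^+ 3 * Qf) + 2 * (r * Qh)) * r)).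
  rewrite ler_wpM2r ?(ltW r0)// (le_trans B2)// lerD// ler_wpM2l//.
have -> : (2 * (81 * M ^+ 2 / r ^+ 3 * Qf) + 2 * (r * Qh)) * r =
    162 * M ^+ 2 * (r ^- 2 * Qf) + 2 * (r ^+ 2 * Qh).
  by field; rewrite gt_eqF.
have X0 : 0 <= r ^- 2 * Qf by rewrite mulr_ge0// invr_ge0 sqr_ge0.
have Y0 : 0 <= r ^+ 2 * Qh by rewrite mulr_ge0// sqr_ge0.
have M20 := sqr_ge0 M.
move: (r ^- 2 * Qf) (r ^+ 2 * Qh) (M ^+ 2) X0 Y0 M20; clear => X Y N X0 Y0 N0.
by have := mulr_ge0 N0 Y0; lra.
Qed.

(** * Gluing local bounds along a tiling *)

Lemma ge0_integral_itv_split (R : realType) (F : R -> \bar R) (a c e : R) :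
  a <= c -> c < e -> measurable_fun `]a, e[ F -> (forall x, 0 <= F x)%E ->
  (\int[lebesgue_measure]_(x in `]a, e[) F x =
   \int[lebesgue_measure]_(x in `]a, c[) F x
   + \int[lebesgue_measure]_(x in `]c, e[) F x)%E.
Proof.
move=> ac ce mF F0.
have aceE : `]a, e[%classic = `]a, c] `|` `]c, e[ :> set R.
  by rewrite -itv_bndbnd_setU ?bnd_simp.
rewrite [in LHS]aceE ge0_integral_setU//.
- congr (_ + _)%E; symmetry; apply: integral_itv_bndo_bndc.
  by apply: measurable_funS mF => //; apply: subset_itvl; rewrite bnd_simp ltW.
- by rewrite -aceE.
- apply/disj_setPS => x [] /=; rewrite !in_itv/= => /andP[_ xc] /andP[cx _].
  by move: (le_lt_trans xc cx); rewrite ltxx.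
Qed.

Lemma ge0_integral_tiling (R : realType) (G F : R -> \bar R) (a r : R) n :
  0 < r ->
  measurable_fun `]a, a + n%:R * r[ G -> measurable_fun `]a, a + n%:R * r[ F ->
  (forall x, 0 <= G x)%E -> (forall x, 0 <= F x)%E ->
  (forall i, (i < n)%N ->
    \int[lebesgue_measure]_(x in `](a + i%:R * r)%R, (a + i%:R * r + r)%R[) G x <=
    \int[lebesgue_measure]_(x in `](a + i%:R * r)%R, (a + i%:R * r + r)%R[) F x)%E ->
  (\int[lebesgue_measure]_(x in `]a, (a + n%:R * r)%R[) G x <=
   \int[lebesgue_measure]_(x in `]a, (a + n%:R * r)%R[) F x)%E.
Proof.
move=> r0; elim: n => [|n IH] mG mF G0 F0 GF.
  by rewrite mul0r addr0 set_itv_ge ?bnd_simp ?ltxx// !integral_set0.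
have nE : a + n.+1%:R * r = a + n%:R * r + r by rewrite -natr1; ring.
rewrite nE in mG mF *.
have ac : a <= a + n%:R * r by rewrite lerDl mulr_ge0// ltW.
have ce : a + n%:R * r < a + n%:R * r + r by rewrite ltrDl.
rewrite (ge0_integral_itv_split ac ce)// (ge0_integral_itv_split ac ce mF)//.
have sub : `]a, a + n%:R * r[ `<=` `]a, a + n%:R * r + r[.
  by apply: subset_itvl; rewrite bnd_simp ltW.
apply: leeD; last exact: GF.
apply: IH => //; [exact: measurable_funS mG|exact: measurable_funS mF|].
by move=> i ni; apply: GF; exact: ltnW.
Qed.

Lemma ge0_integral_linear (d : measure_display) (T : measurableType d)
    (R : realType) (mu : {measure set T -> \bar R}) (D : set T) (p q : T -> R)
    (a b : R) : measurable D -> measurable_fun D p -> measurable_fun D q ->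
  (forall x, 0 <= p x) -> (forall x, 0 <= q x) -> 0 <= a -> 0 <= b ->
  (\int[mu]_(x in D) (a * p x + b * q x)%:E =
   a%:E * \int[mu]_(x in D) (p x)%:E + b%:E * \int[mu]_(x in D) (q x)%:E)%E.
Proof.
move=> mD mp mq p0 q0 a0 b0.
have mE (w : T -> R) : measurable_fun D w -> measurable_fun D (fun x => (w x)%:E).
  by move=> mw; exact/measurable_EFinP.
rewrite -!ge0_integralZl//; try exact: mE; try by move=> x _; rewrite lee_fin.
rewrite -ge0_integralD//.
- by move=> x _; rewrite mule_ge0 ?lee_fin.
- by apply: measurable_funeM; exact: mE.
- by move=> x _; rewrite mule_ge0 ?lee_fin.
- by apply: measurable_funeM; exact: mE.
Qed.

Lemma interval_interpolation (R : realType) : exists2 C : R, 0 < C &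
  forall (a b : R) (f g h : R -> R) (r : R), 0 < r <= b - a ->
  weak_derivative `]a, b[ 1 f g -> weak_derivative `]a, b[ 1 g h ->
  (\int[lebesgue_measure]_(x in `]a, b[) (g x ^+ 2)%:E <=
   C%:E * ((r ^- 2)%:E * \int[lebesgue_measure]_(x in `]a, b[) (f x ^+ 2)%:E
           + (r ^+ 2)%:E * \int[lebesgue_measure]_(x in `]a, b[) (h x ^+ 2)%:E))%E.
Proof.
have [C C0 loc] := local_interpolation R.
exists (4 * C); first by rewrite mulr_gt0.
move=> a b f g h r /andP[r0 rL] fg gh.
have L0 : 0 < b - a by rewrite (lt_le_trans r0).
(* [N] exceeds [(b - a) / r] but is at most twice it, as [r <= b - a]. The [N] tiles therefore have
   length [s] with [r / 2 <= s <= r], and replacing [s] by [r] costs the factor [4]. *)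
pose N := (Num.truncn ((b - a) / r)).+1.
pose s := (b - a) / N%:R.
have N0 : 0 < N%:R :> R by rewrite ltr0n.
have s0 : 0 < s by rewrite divr_gt0.
have NsE : a + N%:R * s = b by rewrite /s mulrC divfK ?gt_eqF// addrC subrK.
have sr : s <= r.
  rewrite /s ler_pdivrMr// mulrC -ler_pdivrMr// ltW//; exact: truncnS_gt.
have rs : r <= 2 * s.
  rewrite /s mulrA ler_pdivlMr// -ler_pdivlMl// mulrC.
  have q1 : 1 <= (b - a) / r by rewrite ler_pdivlMr// mul1r.
  have : (Num.truncn ((b - a) / r))%:R <= (b - a) / r.
    by rewrite truncn_le (le_trans _ q1).
  rewrite /N -natr1 -mulrA; move: (_ / r) (_%:R) q1; clear => q t ? ?; lra.
have [sr2 sr4] : s ^- 2 <= 4 * r ^- 2 /\ s ^+ 2 <= 4 * r ^+ 2.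
  move: (s) s0 sr rs; clear -r0 => t t0 tr rt; split; last by nra.
  rewrite ler_pdivlMr ?exprn_gt0// mulrC ler_pdivrMr ?exprn_gt0//; nra.
pose J : set R := `]a, b[%classic.
have mJ : measurable (J : set (measurableTypeR R)) by exact: measurable_itv.
have mf : measurable_fun J f by case: fg => -[].
have mg : measurable_fun J g by case: gh => -[].
have mh : measurable_fun J h by case: gh => _ [].
have V2 : 0 <= r ^- 2 by rewrite invr_ge0 sqr_ge0.
pose F x := 4 * C * (r ^- 2 * f x ^+ 2 + r ^+ 2 * h x ^+ 2).
have mf2 : measurable_fun J (fun x => f x ^+ 2) by exact: measurable_funX.
have mg2 : measurable_fun J (fun x => g x ^+ 2) by exact: measurable_funX.
have mh2 : measurable_fun J (fun x => h x ^+ 2) by exact: measurable_funX.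
have mF : measurable_fun J F.
  by apply: measurable_funM => //; apply: measurable_funD; exact: measurable_funM.
have C4 : 0 <= 4 * C by rewrite mulr_ge0// ltW.
have G0 x : 0 <= r ^- 2 * f x ^+ 2 + r ^+ 2 * h x ^+ 2.
  by rewrite addr_ge0// mulr_ge0// sqr_ge0.
(* The right-hand side is rewritten as one integral, so that it can be compared tile by tile. *)
apply: (@le_trans _ _ (\int[lebesgue_measure]_(x in J) (F x)%:E)%E); last first.
  rewrite ge0_muleDr ?mule_ge0 ?lee_fin ?integral_ge0 ?sqr_ge0//; last 2 first.
  - by move=> x _; rewrite lee_fin sqr_ge0.
  - by move=> x _; rewrite lee_fin sqr_ge0.
  rewrite !muleA -!EFinM.
  rewrite -(ge0_integral_linear lebesgue_measure mJ mf2 mh2 _ _ (mulr_ge0 C4 V2)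
    (mulr_ge0 C4 (sqr_ge0 r))); try by move=> x; exact: sqr_ge0.
  by under [leLHS]eq_integral do rewrite /F mulrDr 2![4 * C * (_ * _)]mulrA.
have Jm (S : set R) (w : R -> R) : S `<=` J -> measurable_fun J w -> measurable_fun S (EFin \o w).
  by move=> SJ mw; apply/measurable_EFinP; exact: measurable_funS mw.
have mG' : measurable_fun `]a, a + N%:R * s[ (EFin \o (fun x => g x ^+ 2)) by rewrite NsE; exact: Jm.
have mF' : measurable_fun `]a, a + N%:R * s[ (EFin \o F) by rewrite NsE; exact: Jm.
have := ge0_integral_tiling s0 mG' mF'; rewrite NsE; apply.
- by move=> x; rewrite lee_fin sqr_ge0.
- by move=> x; rewrite lee_fin mulr_ge0.
move=> i iN.
set c := a + i%:R * s; set e := c + s.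
have ce : c < e by rewrite ltrDl.
have sub : `]c, e[ `<=` J.
  apply: subset_itv; rewrite bnd_simp; first by rewrite lerDl mulr_ge0// ltW.
  rewrite -NsE /e /c -addrA lerD2l -[X in _ + X]mul1r -mulrDl ler_wpM2r ?(ltW s0)//.
  by rewrite natr1 ler_nat.
have oce : open (`]c, e[%classic : set R) by exact: interval_open.
have := loc c e f g h ce (weak_derivativeS oce sub fg) (weak_derivativeS oce sub gh).
move=> /le_trans; apply.
have ecs : e - c = s by rewrite /e addrAC subrr add0r.
rewrite ecs; apply: ge0_le_integral => //.
- move=> x _; rewrite lee_fin mulr_ge0 ?(ltW C0)// addr_ge0// mulr_ge0 ?sqr_ge0//.
  by rewrite invr_ge0 sqr_ge0.
- apply: (Jm _ (fun x => C * (s ^- 2 * f x ^+ 2 + s ^+ 2 * h x ^+ 2))) => //.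
  by apply: measurable_funM => //; apply: measurable_funD; exact: measurable_funM.
- exact: Jm.
move=> x _; rewrite lee_fin /F [4 * C]mulrC -[leRHS]mulrA ler_wpM2l ?(ltW C0)// mulrDr.
rewrite lerD//.
  by rewrite [4 * (_ * _)]mulrA ler_wpM2r ?sqr_ge0.
by rewrite [4 * (_ * _)]mulrA ler_wpM2r ?sqr_ge0.
Qed.

(** * Interpolation between non-consecutive derivatives *)

(** The model is [B i = r ^ (2 i) |w_i| ^ 2]: multiplying by powers of [r] removes it from the
    interpolation inequality, and [t] records a length [r * sqrt t] shorter than [r]. *)
Definition interpolates (R : realType) (C : R) (n : nat) (B : nat -> R) : Prop :=
  (forall i, 0 <= B i) /\
  (forall i t, (i.+1 < n)%N -> 0 < t <= 1 ->
     B i.+1 <= C * (t^-1 * B i + t * B i.+2)).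

(** The bound for [B j.+1] is inserted into the next three-term inequality. The power of [t^-1] on
    [B 0] is the price of a small factor on [B j.+2], which allows that term to be absorbed. *)
Lemma interpolates_first (R : realType) (C : R) (j : nat) : 1 <= C ->
  exists2 K : R, 1 <= K & forall n B, interpolates C n B -> (j.+1 < n)%N ->
  forall t, 0 < t <= 1 -> B j.+1 <= K * (t^-1 ^+ j.+1 * B 0%N + t * B j.+2).
Proof.
move=> C1; elim: j => [|j [K K1 IH]].
  by exists C => // n B [_ BC] jn t t01; rewrite expr1; exact: BC.
have C0 : 0 < C by exact: lt_le_trans C1.
have K0 : 0 < K by exact: lt_le_trans K1.
(* The induction hypothesis is used at [s / D], so that half of [B j.+2] is absorbed. *)
pose D := 2 * C * K.
have CK : C <= C * K by rewrite ler_peMr// ltW.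
have D1 : 1 <= D by rewrite /D -mulrA; lra.
have D0 : 0 < D by exact: lt_le_trans D1.
exists (D ^+ j.+2); first by rewrite exprn_ege1.
move=> n B BC jn s /andP[s0 s1]; have [B0 BCi] := BC.
have t0 : 0 < s / D by rewrite divr_gt0.
have t01 : 0 < s / D <= 1.
  by rewrite t0 ler_pdivrMr// mul1r (le_trans s1).
have h1 := IH n B BC (ltnW jn) _ t01.
have h2 : B j.+2 <= C * (s^-1 * B j.+1 + s * B j.+3) by apply: BCi; rewrite ?s0.
have h3 : C * s^-1 * B j.+1 <=
    C * s^-1 * (K * ((s / D)^-1 ^+ j.+1 * B 0%N + s / D * B j.+2)).
  by rewrite ler_wpM2l//; apply: mulr_ge0; [exact: ltW|rewrite invr_ge0 ltW].
have e1 : C * s^-1 * (K * ((s / D)^-1 ^+ j.+1 * B 0%N + s / D * B j.+2)) =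
    2^-1 * (D ^+ j.+2 * (s^-1 ^+ j.+2 * B 0%N)) + 2^-1 * B j.+2.
  rewrite invfM invrK exprMn [s^-1 ^+ j.+2]exprS [D ^+ j.+2]exprS.
  move: (s^-1 ^+ j.+1) (D ^+ j.+1) (B 0%N) (B j.+2) => x y z w.
  by rewrite /D; field; rewrite !gt_eqF.
have DC : 2 * C <= D ^+ j.+2.
  apply: (@le_trans _ _ D); first by rewrite /D -mulrA; lra.
  by rewrite exprS ler_peMr ?(ltW D0)// exprn_ege1.
have h4 : 2 * C * (s * B j.+3) <= D ^+ j.+2 * (s * B j.+3).
  by rewrite ler_wpM2r// mulr_ge0// ltW.
rewrite e1 in h3; rewrite mulrDr mulrA in h2; rewrite mulrDr.
move: h2 h3 h4; move: (C * s^-1 * B j.+1) (D ^+ j.+2 * (s^-1 ^+ j.+2 * B 0%N)).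
move: (s * B j.+3) (B j.+2) (D ^+ _) => x y z u v; clear => h2 h3 h4; nra.
Qed.

(** Descending induction from [n]: at [t = 1], [interpolates_first] bounds each term by [B 0] and
    the following term, which is already under control. *)
Lemma interpolates_bound (R : realType) (C : R) (n : nat) : 1 <= C -> (0 < n)%N ->
  exists2 K : R, 1 <= K & forall B, interpolates C n B ->
  forall j, (0 < j <= n)%N -> B j <= K * (B 0%N + B n).
Proof.
move=> C1 n0.
suff H i : (i < n)%N -> exists2 K : R, 1 <= K & forall B, interpolates C n B ->
    forall j, (n - i <= j <= n)%N -> B j <= K * (B 0%N + B n).
  have [|K K1 KB] := H n.-1; first by rewrite prednK.
  by exists K => // B BC j j0n; apply: KB => //; lia.
elim: i => [|i IH] iN.
  exists 1 => // B [B0 _] j jn; have -> : j = n by lia.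
  by rewrite mul1r lerDr.
have [K K1 KB] := IH (ltnW iN).
(* As [i.+1 < n], the successor of [n - i.+2] is [n - i.+1], the one new index. *)
have [K' K'1 KB'] := @interpolates_first R C (n - i.+2) C1.
have KK : 1 <= K' * (1 + K) by rewrite mulr_ege1// lerDl (le_trans _ K1).
exists (K' * (1 + K)) => // B BC j jn; have [B0 _] := BC.
have s0 : 0 <= B 0%N + B n by rewrite addr_ge0.
have KK' : K <= K' * (1 + K) by nra.
have [->|jni] := eqVneq j (n - i.+1)%N; last first.
  apply: le_trans (KB B BC j _) _; first lia.
  by rewrite ler_wpM2r.
have nE : (n - i.+1 = (n - i.+2).+1)%N by lia.
have nE' : (n - i = (n - i.+1).+1)%N by lia.
have h1 := KB B BC (n - i)%N; rewrite leqnn leq_subr in h1; have {}h1 := h1 isT.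
have h2 := KB' n B BC _ 1; rewrite -nE -nE' lexx ltr01 in h2.
rewrite invr1 expr1n !mul1r in h2; have {}h2 := h2 _ isT.
apply: (le_trans (h2 _)); first lia.
rewrite -mulrA ler_wpM2l ?(le_trans _ K'1)//.
have := B0 n; move: h1; move: (B (n - i)%N) (B 0%N) (B n); clear => x y z; nra.
Qed.

(** * Chains of weak derivatives and squared norms *)

Lemma weak_derivative_succ (R : realType) (D : set R) j (u v w : R -> R) :
  weak_derivative D j u v -> weak_derivative D j.+1 u w -> weak_derivative D 1 v w.
Proof.
move=> [_ lv uv] [_ lw uw]; split => // phi tphi.
have tdphi : test_function D (derive1 phi).
  case: tphi => sphi [K [cK KD phi0]]; split.
    by move=> n x; rewrite -derive1Sn; exact: sphi.
  exists K; split => //.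
  by apply: (@derive1n_eq0 _ phi K 1) => //; apply: compact_closed => //; exact: Rhausdorff.
(* Testing order [j] against [phi'] and order [j.+1] against [phi] gives the same integral; the
   common sign [(-1) ^ j] cancels. *)
have := uw _ tphi; rewrite derive1Sn (uv _ tdphi) exprSr -mulrA.
by move/mulfI; apply; rewrite signr_eq0.
Qed.

Lemma L2norm_sqr (R : realType) (D : set R) (f : R -> R) :
  (L2norm D f ^+ 2 = \int[lebesgue_measure]_(x in D) (f x ^+ 2)%:E)%E.
Proof.
have sqrE (x : \bar R) : (0 <= x -> x ^+ 2 = x `^ 2)%E.
  case: x => [r||] //=; last first.
    by rewrite pnatr_eq0 mulyy.
  by rewrite lee_fin => r0; rewrite powR_mulrn// expr2 EFinM.
rewrite /L2norm sqrE ?Lnorm_ge0// poweR_Lnorm//.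
rewrite [RHS]integral_mkcond; apply: eq_integral => x _ /=.
rewrite patchE; case: ifPn => [xD|xD]; rewrite !patchE ?xD ?(negbTE xD).
  by rewrite powR_mulrn// real_normK// num_real.
by rewrite normr0 powR0// pnatr_eq0.
Qed.

Lemma L2_sqr_integral_lty (R : realType) (D : set R) (f : R -> R) : L2 D f ->
  (\int[lebesgue_measure]_(x in D) (f x ^+ 2)%:E < +oo)%E.
Proof.
move=> /andP[_]; rewrite inE /finite_norm => fin; rewrite -L2norm_sqr.
by rewrite expe2 lte_mul_pinfty ?ge0_fin_numE ?Lnorm_ge0.
Qed.

(** For [delta <= L] take [r = delta]. Otherwise take [r = L] and multiply by [(delta / L) ^ (2 m)]:
    the [A0] term becomes the last one of the conclusion, and
    [L ^ (2 (n - m)) <= delta ^ (2 (n - m))] handles [A2]. *)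
Lemma scaled_interpolation (R : realType) (K L delta A0 A1 A2 : R) (m n : nat) :
  (m <= n)%N -> 0 < K -> 0 < L -> 0 < delta -> 0 <= A0 -> 0 <= A1 -> 0 <= A2 ->
  (forall r, 0 < r <= L -> r ^+ (2 * m) * A1 <= K * (A0 + r ^+ (2 * n) * A2)) ->
  delta ^+ (2 * m) * A1 <=
    K * (A0 + delta ^+ (2 * n) * A2 + delta ^+ (2 * m) / L ^+ (2 * m) * A0).
Proof.
move=> mn K0 L0 d0 a0 a1 a2 H.
have [dL|Ld] := leP delta L.
  have := H delta; rewrite d0 dL => /(_ isT) h; apply: (le_trans h).
  rewrite ler_wpM2l ?(ltW K0)// lerDl mulr_ge0// mulr_ge0 ?invr_ge0 ?exprn_ge0 ?(ltW d0)//.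
  by rewrite ltW.
have := H L; rewrite L0 lexx => /(_ isT) h.
have Lm0 : 0 < L ^+ (2 * m) by rewrite exprn_gt0.
have dm0 : 0 < delta ^+ (2 * m) by rewrite exprn_gt0.
have q0 : 0 <= delta ^+ (2 * m) / L ^+ (2 * m) by rewrite divr_ge0 ?(ltW Lm0) ?(ltW dm0).
have -> : delta ^+ (2 * m) * A1 =
    delta ^+ (2 * m) / L ^+ (2 * m) * (L ^+ (2 * m) * A1).
  by rewrite mulrA divfK// gt_eqF.
apply: (le_trans (ler_wpM2l q0 h)); rewrite mulrCA ler_wpM2l ?(ltW K0)// mulrDr.
have nE : (2 * n = 2 * m + 2 * (n - m))%N by rewrite -mulnDr subnKC.
have dL : L ^+ (2 * (n - m)) <= delta ^+ (2 * (n - m)).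
  by rewrite lerXn2r ?nnegrE ?(ltW L0) ?(ltW d0)// ltW.
have e1 : delta ^+ (2 * m) / L ^+ (2 * m) * (L ^+ (2 * n) * A2) <= delta ^+ (2 * n) * A2.
  rewrite nE [L ^+ (_ + _)]exprD [delta ^+ (_ + _)]exprD.
  rewrite mulrA mulrA divfK ?gt_eqF//; apply: ler_wpM2r => //.
  by apply: ler_wpM2l => //; exact: ltW.
by rewrite addrC lerD2r (le_trans e1)// lerDr.
Qed.

(** * Assembling the chain of derivatives at the right scale *)

Theorem lemma7 (R : realType) (k : nat) (hk : (3 <= k)%N) :
  exists2 Rk : R, 0 < Rk &
  forall (a b : R), a < b ->
  forall u : R -> R, Hk k `]a, b[ u ->
  forall l : nat, (2 <= l <= k - 1)%N ->
  forall eps : R, 0 < eps < 1 ->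
  forall u1 ul uk : R -> R,
    weak_derivative `]a, b[ 1 u u1 ->
    weak_derivative `]a, b[ l u ul ->
    weak_derivative `]a, b[ k u uk ->
  ((eps `^ gamma_exp R k l)%:E * L2norm `]a, b[ ul ^+ 2 <=
   Rk%:E * (L2norm `]a, b[ u1 ^+ 2
            + (eps ^+ (2 * k - 1))%:E * L2norm `]a, b[ uk ^+ 2
            + (eps `^ gamma_exp R k l / (b - a) ^+ (2 * (l - 1)))%:E
              * L2norm `]a, b[ u1 ^+ 2))%E.
Proof.
have [C C0 interp] := interval_interpolation R.
(* [interpolates_bound] takes a constant at least [1], while [C] is only positive. *)
have C1 : 1 <= C + 1 by rewrite lerDr ltW.
have k10 : (0 < k - 1)%N by lia.
have [K K1 KB] := interpolates_bound C1 k10.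
have K0 : 0 < K by exact: lt_le_trans K1.
exists K => // a b ab u [_ uH] l l2k eps /andP[eps0 eps1] u1 ul uk w1 wl wk.
have /andP[l1 lk] : (1 < l < k)%N by lia.
have predl : (0 < l.-1 <= k)%N by lia.
have predl_neq : l.-1 <> l by lia.
have succl : (0 < l.+1 <= k)%N by lia.
have succl_neq : l.+1 <> l by lia.
have ne1l : 1%N <> l by move=> h; move: l1; rewrite -h.
have ne1k : 1%N <> k by move=> h; move: hk; rewrite -h.
have nelk : l <> k by move=> h; move: lk; rewrite h ltnn.
have L0 : 0 < b - a by rewrite subr_gt0.
have Lm0 m : 0 < (b - a) ^+ m by rewrite exprn_gt0.
rewrite !L2norm_sqr.
pose A (w : R -> R) := (\int[lebesgue_measure]_(x in `]a, b[) (w x ^+ 2)%:E)%E.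
rewrite -/(A u1) -/(A ul) -/(A uk).
have A0 w : (0 <= A w)%E by apply: integral_ge0 => x _; rewrite lee_fin sqr_ge0.
have q0 : 0 < eps `^ gamma_exp R k l / (b - a) ^+ (2 * (l - 1)).
  by rewrite divr_gt0// powR_gt0.
have e0 : 0 < eps ^+ (2 * k - 1) by rewrite exprn_gt0.
(* If [u1] or [uk] has infinite norm, the right-hand side is infinite because its coefficients are
   positive. *)
have [u1oo|u1fin] := eqVneq (A u1) +oo%E.
  rewrite u1oo gt0_muley ?lte_fin// !addye ?gt0_muley ?lte_fin ?leey//.
  by rewrite gt_eqF// (lt_le_trans (ltNyr 0))// mule_ge0// lee_fin ltW.
have [ukoo|ukfin] := eqVneq (A uk) +oo%E.
  rewrite ukoo gt0_muley ?lte_fin// addey ?addye ?gt0_muley ?lte_fin ?leey//.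
    by rewrite gt_eqF// (lt_le_trans (ltNyr 0))// mule_ge0// lee_fin ltW.
  by rewrite gt_eqF// (lt_le_trans (ltNyr 0)).
(* One weak derivative is fixed for each order: the given [u1], [ul], [uk] at [1], [l], [k], those
   supplied by [Hk] at the other orders up to [k], and a dummy value elsewhere. *)
have /boolp.choice[w wP] : forall j, exists v : R -> R,
    [/\ (0 < j <= k)%N -> weak_derivative `]a, b[ j u v,
        [/\ j = 1%N -> v = u1, j = l -> v = ul & j = k -> v = uk] &
        (0 < j <= k)%N -> j <> l -> (A v < +oo)%E].
  move=> j.
  have [->|/eqP j1] := eqVneq j 1%N.
    by exists u1; split => //; move=> _ _; rewrite ltey.
  have [->|/eqP jl] := eqVneq j l.
    by exists ul; split => //; split => // h; case: ne1l.
  have [->|/eqP jk] := eqVneq j k.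
    exists uk; split => //; last by move=> _ _; rewrite ltey.
    by split => // h; [case: ne1k|case: nelk].
  have [jk'|jk'] := boolP (0 < j <= k)%N; last by exists u1; split.
  by have [v vu /L2_sqr_integral_lty vfin] := uH _ jk'; exists v; split.
have wd j : (0 < j <= k)%N -> weak_derivative `]a, b[ j u (w j) by case: (wP j).
have wchain j : (0 < j < k)%N -> weak_derivative `]a, b[ 1 (w j) (w j.+1).
  move=> /andP[j0 jk]; apply: weak_derivative_succ (wd j _) (wd j.+1 _) => //.
  by rewrite j0 ltnW.
have w1E : w 1%N = u1 by have [_ [h _ _] _] := wP 1%N; exact: h.
have wlE : w l = ul by have [_ [_ h _] _] := wP l; exact: h.
have wkE : w k = uk by have [_ [_ _ h] _] := wP k; exact: h.
have step j r : (0 < j)%N -> (j.+1 < k)%N -> 0 < r <= b - a ->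
    (A (w j.+1) <= C%:E * ((r ^- 2)%:E * A (w j) + (r ^+ 2)%:E * A (w j.+2)))%E.
  move=> j0 jk rL; apply: interp => //; apply: wchain => //.
  by rewrite j0 ltnW.
have Afin j : (0 < j <= k)%N -> A (w j) \is a fin_num.
  move=> jk; rewrite ge0_fin_numE//.
  have [jl|/eqP jl] := eqVneq j l; last by have [_ _] := wP j; apply.
  (* [ul] is an arbitrary weak derivative, so its integrability comes from its neighbours. *)
  rewrite jl -[l]prednK; last exact: ltnW l1.
  have Aother i : (0 < i <= k)%N -> i <> l -> A (w i) \is a fin_num.
    by move=> ik il; rewrite ge0_fin_numE//; have [_ _] := wP i; apply.
  apply: le_lt_trans (step l.-1 (b - a) _ _ _) _.
  - by rewrite -ltnS prednK// ltnW.
  - by rewrite prednK// ltnW.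
  - by rewrite L0 lexx.
  apply: lte_mul_pinfty; rewrite ?lee_fin ?(ltW C0)//.
  rewrite prednK ?(ltnW l1)//; apply: lte_add_pinfty; apply: lte_mul_pinfty;
    rewrite ?lee_fin ?invr_ge0 ?sqr_ge0// -ge0_fin_numE//; apply: Aother.
  - exact: predl.
  - exact: predl_neq.
  - exact: succl.
  - exact: succl_neq.
pose x j := fine (A (w j)).
have x0 j : 0 <= x j by exact: fine_ge0.
have xE j : (0 < j <= k)%N -> A (w j) = (x j)%:E by move=> jk; rewrite fineK ?Afin.
have k1 : (0 < 1 <= k)%N by rewrite (ltn_trans _ hk).
have kk : (0 < k <= k)%N by rewrite leqnn (ltn_trans _ hk).
have ll : (0 < l <= k)%N by rewrite (ltnW l1) ltnW.
rewrite -w1E -wlE -wkE (xE _ k1) (xE _ ll) (xE _ kk) -!EFinM lee_fin.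
(* The exponent is the one for which [delta ^ (2 (l - 1))] and [delta ^ (2 (k - 1))] are both the
   weights of the statement. *)
pose delta := eps `^ ((2 * k%:R - 1) / (2 * (k%:R - 1))).
have kR : k%:R - 1 != 0 :> R by rewrite subr_eq0 (eqr_nat _ k 1) gtn_eqF// (ltn_trans _ hk).
have dm : delta ^+ (2 * (l - 1)) = eps `^ gamma_exp R k l.
  rewrite -powR_mulrn ?powR_ge0// -powRrM natrM natrB ?(ltnW l1)//; congr (_ `^ _).
  by rewrite /gamma_exp; move: (k%:R) (l%:R) kR; clear => y z y0; field.
have dn : delta ^+ (2 * (k - 1)) = eps ^+ (2 * k - 1).
  rewrite -[RHS]powR_mulrn ?(ltW eps0)// -powR_mulrn ?powR_ge0// -powRrM.
  have k2 : (1 <= 2 * k)%N by rewrite muln_gt0/= (ltn_trans _ hk).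
  have k0 : (1 <= k)%N by exact: ltn_trans hk.
  rewrite natrM (natrB _ k0) (natrB _ k2) natrM; congr (_ `^ _).
  by move: (k%:R) kR; clear => y y0; field.
rewrite -dm -dn; apply: scaled_interpolation => //.
- by rewrite leq_sub2r// ltnW.
- exact: powR_gt0.
move=> r /andP[r0 rL].
(* The shift puts [u1] at index [0], [ul] at [l - 1] and [uk] at [k - 1]. *)
pose B i := r ^+ (2 * i) * x i.+1.
have Bint : interpolates (C + 1) (k - 1) B.
  split=> [i|i t ik /andP[t0 t1]]; first by rewrite mulr_ge0// exprn_ge0// ltW.
  have ik3 : (0 < i.+3 <= k)%N by move: ik; rewrite ltn_subRL add1n.
  have ik2 : (0 < i.+2 <= k)%N by rewrite /= ltnW//; case/andP: ik3.
  have ik1 : (0 < i.+1 <= k)%N by rewrite /= ltnW//; case/andP: ik2.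
  (* The length [r * sqrt t] is admissible because [t <= 1], and its square brings in exactly
     [t]. *)
  have st0 : 0 < r * Num.sqrt t by rewrite mulr_gt0// sqrtr_gt0.
  have stL : r * Num.sqrt t <= b - a.
    by rewrite (le_trans _ rL)// ler_piMr ?(ltW r0)// -sqrtr1 ler_wsqrtr.
  have h : x i.+2 <= C * ((r * Num.sqrt t) ^- 2 * x i.+1 + (r * Num.sqrt t) ^+ 2 * x i.+3).
    rewrite -lee_fin EFinM EFinD !EFinM -(xE _ ik1) -(xE _ ik2) -(xE _ ik3).
    by apply: step => //; rewrite st0.
  rewrite exprMn sqr_sqrtr ?(ltW t0)// in h.
  have rE j : r ^+ (2 * j.+1) = r ^+ 2 * r ^+ (2 * j) by rewrite mulnS exprD.
  rewrite /B !rE; have rr0 : 0 < r ^+ (2 * i) by rewrite exprn_gt0.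
  move: h (x0 i.+1) (x0 i.+3) rr0.
  move: (x i.+1) (x i.+2) (x i.+3) (r ^+ (2 * i)) => x1 x2 x3 q.
  move: (C) C0 (r) r0 (t) t0; clear => C C0 r r0 t t0 h y1 y3 qq.
  have rt0 : 0 < r ^+ 2 * q by rewrite mulr_gt0// exprn_gt0.
  have := ler_wpM2l (ltW rt0) h.
  have -> : r ^+ 2 * q * (C * ((r ^+ 2 * t)^-1 * x1 + r ^+ 2 * t * x3)) =
      C * (t^-1 * (q * x1) + t * (r ^+ 2 * (r ^+ 2 * q) * x3)).
    by field; rewrite !gt_eqF.
  move/le_trans; apply; rewrite ler_wpM2r// ?lerDl//.
  apply: addr_ge0; apply: mulr_ge0; [by rewrite invr_ge0 ltW|exact: mulr_ge0 (ltW qq) y1|exact: ltW|].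
  by apply: mulr_ge0 => //; rewrite ltW// mulr_gt0// exprn_gt0.
have := KB B Bint (l - 1)%N; rewrite /B.
have -> : (l - 1).+1 = l by rewrite subn1 prednK// ltnW.
have -> : (k - 1).+1 = k by rewrite subn1 prednK//; case/andP: kk.
rewrite muln0 expr0 mul1r; apply.
by rewrite subn_gt0 l1 leq_sub2r// ltnW.
Qed.
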